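(* Let $q=2^m$ with $m$ even and let $n\ge 1$ be an integer. There is a Kakeya set $K\subset \mathbb{F}_q^n$ such that $$ |K| < \frac{2q}{q+\sqrt{q}-2}\left(\frac{q+\sqrt{q}}{2}\right)^n . $$
   Context: $\mathbb{F}_q$ denotes the finite field with $q$ elements (so $m\ge 1$). A set $K\subset\mathbb{F}_q^n$ is a Kakeya set if for every $\mathbf{x}\in\mathbb{F}_q^n$ there exists $\mathbf{y}\in\mathbb{F}_q^n$ such that $\{\mathbf{y}+t\mathbf{x} : t\in\mathbb{F}_q\}\subset K$. *)

(* Defs.v *)
From mathcomp Require Import all_boot all_order all_algebra.

Set Implicit Arguments.
Unset Strict Implicit.
Unset Printing Implicit Defensive.

Import GRing.Theory.
Local Open Scope ring_scope.

Definition line (F : finFieldType) (n : nat) (y x : 'rV[F]_n) : {set 'rV[F]_n} :=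
  [set y + t *: x | t : F].

(* The direction x = 0 is included; it only forces K to be nonempty. *)
Definition kakeya (F : finFieldType) (n : nat) (K : {set 'rV[F]_n}) : Prop :=
  forall x : 'rV[F]_n, exists y : 'rV[F]_n, line y x \subset K.

(* Main.v *)
Require Import Defs.
From mathcomp Require Import all_boot all_order all_algebra.
From mathcomp Require Import finfield.
From mathcomp Require Import ring lra.
Import Order.TTheory GRing.Theory Num.Theory.
Local Open Scope ring_scope.

(** Given a map [f] of the field, the lines y + t *: x with
    y = (f x_0, ..., f x_(j-1), 0, ..., 0), for x = (x_0, ..., x_(j-1), 1, 0,
    ..., 0), meet the hyperplane where coordinate [j] equals [t] in points
    whose first [j] coordinates lie in I(t) = { f z + t * z }. Every nonzero
    direction is proportional to such an [x] (its last nonzero coordinate is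
    the [j]-th), so if all the sets I(t) have at most [M] elements, the union
    of these lines sits in a Kakeya set with at most
    q * (1 + M + ... + M ^ (n - 1)) elements ([exists_kakeya_slope_image]).

    For q = s ^ 2 with s a power of 2, the choice f z = z ^ (s + 1), the norm
    [N] from GF(q) to GF(s), gives M = (q + s) / 2 ([card_slope_image_norm]).
    If t = 0, then I(t) lies in GF(s). If t != 0, then f z + t * z takes the
    same value at z and at z + e / t, where e = N t + Tr (t * z) and
    Tr u = u ^ s + u; the points where e = 0 are the roots of a polynomial of
    degree [s], so all but at most [s] points share their value with another
    point. Summing the geometric progression gives the bound. *)

(** The set of values of [f z + t * z]; equivalently, the lines of slope
    [- t] that meet the graph of [f]. *)
Definition slope_image {F : finFieldType} (f : F -> F) (t : F) : {set F} :=
  [set f z + t * z | z : F].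

(** A box with sides [A i] has as many points as the product of its sides. *)
Lemma card_rV_box (F : finFieldType) (n : nat) (A : 'I_n -> {set F}) :
  #|[set v : 'rV[F]_n | [forall i, v 0 i \in A i]]| = (\prod_i #|A i|)%N.
Proof.
have inj : injective (fun g : {ffun 'I_n -> F} => \row_i g i : 'rV[F]_n).
  by move=> g h /rowP e; apply/ffunP => i; have := e i; rewrite !mxE.
transitivity #|family A|; last by rewrite card_family foldrE big_map big_enum.
rewrite -(card_imset _ inj); apply: eq_card => v; rewrite inE.
apply/forallP/imsetP => [Av | [g /familyP Ag ->] i]; last by rewrite mxE; apply: Ag.
exists [ffun i => v 0 i]; last by apply/rowP => i; rewrite mxE ffunE.
by apply/familyP => i; rewrite ffunE; apply: Av.
Qed.

Lemma card_ord_ltn (n : nat) (j : 'I_n) : #|[pred i : 'I_n | (i < j)%N]| = j.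
Proof.
rewrite -sum1_card (eq_bigl (fun i : 'I_n => (i < j)%N)) //.
by rewrite (big_ord_narrow (ltnW (ltn_ord j))) sum1_card card_ord.
Qed.

Lemma leq_card_bigcup (I T : finType) (A : I -> {set T}) :
  (#|\bigcup_i A i| <= \sum_i #|A i|)%N.
Proof.
elim/big_rec2: _ => [|i k X _ leX]; first by rewrite cards0.
exact: leq_trans (leq_card_setU _ _) (leq_add (leqnn _) leX).
Qed.

(** The Kakeya set is the union over [j] and [t] of the boxes
    I(t) ^ j * {t} * {0} ^ (n - j - 1), where I(t) = [slope_image f t]. *)
Lemma exists_kakeya_slope_image (F : finFieldType) (f : F -> F) (M n : nat) :
  (0 < n)%N -> (forall t, (#|slope_image f t| <= M)%N) ->
  exists2 K : {set 'rV[F]_n},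
    kakeya K & (#|K| <= #|F| * \sum_(j < n) M ^ j)%N.
Proof.
move=> n_gt0 leM.
pose A (j : nat) t (i : 'I_n) : {set F} :=
  if (i < j)%N then slope_image f t
  else if i == j :> nat then [set t] else [set 0].
pose B (j : 'I_n) t := [set v : 'rV[F]_n | [forall i, v 0 i \in A j t i]].
exists (\bigcup_j \bigcup_t B j t) => [x|]; last first.
  apply: leq_trans (leq_card_bigcup _ _ _) _.
  rewrite big_distrr /=; apply: leq_sum => j _.
  apply: leq_trans (leq_card_bigcup _ _ _) _.
  rewrite -sum_nat_const; apply: leq_sum => t _.
  rewrite card_rV_box -{2}(card_ord_ltn _ j) -prod_nat_const big_mkcond /=.
  rewrite [leqRHS]big_mkcond /=; apply: leq_prod => i _.
  by rewrite inE /A; do 2?case: ifP; rewrite ?cards1.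
suff [j [y Bj]] : exists (j : 'I_n) y, forall t, exists u, y + t *: x \in B j u.
  exists y; apply/subsetP => v /imsetP[t _ ->]; have [u Bu] := Bj t.
  by apply/bigcupP; exists j => //; apply/bigcupP; exists u.
have [x0 | nz_x] := eqVneq x 0.
  exists (Ordinal n_gt0), 0 => t; exists 0.
  rewrite x0 scaler0 addr0 inE; apply/forallP => i; rewrite mxE /A ltn0.
  by case: ifP; rewrite inE.
have [i0 nz_i0] : exists i, x 0 i != 0 by apply/rV0Pn.
(* [j] is the last nonzero coordinate of the direction. *)
case: (@arg_maxnP _ i0 (fun i => x 0 i != 0) val nz_i0) => j nz_j max_j.
exists j, (\row_i if (i < j)%N then f (x 0 i / x 0 j) else 0) => t.
(* The point of parameter [t] has [j]-th coordinate [t * x 0 j]. *)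
exists (t * x 0 j); rewrite inE; apply/forallP => i; rewrite !mxE /A.
case: ltngtP => [lt_ij | lt_ji | /val_inj ->].
- apply/imsetP; exists (x 0 i / x 0 j) => //.
  by rewrite -mulrA [x 0 j * _]mulrCA divff // mulr1.
- rewrite inE add0r mulf_eq0; apply/orP; right; apply/negPn/negP => /max_j.
  by rewrite /= leqNgt lt_ji.
- by rewrite inE add0r.
Qed.

(** If every point outside [A] shares its value under [g] with another point,
    the values are attained at least twice, except for at most #|A| of them. *)
Lemma leq_double_card_imset (T U : finType) (g : T -> U) (A : {set T}) :
  (forall x, x \notin A -> exists2 y, y != x & g y = g x) ->
  (2 * #|[set g x | x : T]| <= #|T| + #|A|)%N.
Proof.
move=> dup.
have fib (D : {set T}) :
    #|D| = (\sum_(u in [set g x | x : T]) #|[set x in D | g x == u]|)%N.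
  rewrite -sum1_card (partition_big g [in [set g x | x : T]]) => [|x _];
    last exact: imset_f.
  by apply: eq_bigr => u _; rewrite -sum1_card; apply: eq_bigl => x; rewrite inE.
rewrite -cardsT (fib setT) (fib A) -big_split /= mulnC -sum_nat_const.
apply: leq_sum => _ /imsetP[x _ ->].
have [Ax | /dup[y ne_yx eq_g]] := boolP (x \in A).
  by apply: (@leq_add 1 1); rewrite card_gt0; apply/set0Pn; exists x;
    rewrite !inE ?Ax eqxx.
apply: leq_trans (leq_addr _ _).
have <- : #|[set x; y]| = 2%N by rewrite cards2 eq_sym ne_yx.
apply: subset_leq_card; apply/subsetP => z.
by rewrite !inE => /orP[] /eqP ->; rewrite ?eq_g eqxx.
Qed.

Lemma card_binomial_fiber_leq (F : finFieldType) (a b c : F) (s : nat) :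
  (1 < s)%N -> a != 0 ->
  (#|[set z : F | a * z ^+ s + b * z == c]%R| <= s)%N.
Proof.
move=> s_gt1 nz_a; pose p := a *: 'X^s + (b *: 'X - c%:P).
have sz : size p = s.+1.
  rewrite size_polyDl size_scale ?size_polyXn //.
  rewrite ltnS (leq_trans _ s_gt1) // (leq_trans (size_polyD _ _)) //.
  rewrite geq_max size_polyN (leq_trans (size_scale_leq _ _)) ?size_polyX //.
  by rewrite (leq_trans (size_polyC_leq1 _)).
have nz_p : p != 0 by rewrite -size_poly_eq0 sz.
rewrite -ltnS -sz cardE; apply: max_poly_roots => //; last exact: enum_uniq.
apply/allP => z; rewrite mem_enum inE => /eqP eq_c.
by rewrite /root !hornerE -eq_c; apply/eqP; exact: subrr.
Qed.

(** The parameter [2 ^ k] is the square root s of the order of the field, so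
    z ^ (s + 1) is the norm to the subfield of order s, and the bound on the
    cardinal is (s ^ 2 + s) / 2. *)
Lemma card_slope_image_norm (F : finFieldType) (k : nat) (t : F) :
  (0 < k)%N -> #|F| = ((2 ^ k) ^ 2)%N ->
  (2 * #|slope_image (fun z : F => z ^+ (2 ^ k).+1) t| <= #|F| + 2 ^ k)%N.
Proof.
move=> k_gt0; set s := (2 ^ k)%N => cardF.
have s_gt1 : (1 < s)%N by rewrite -{1}(expn0 2) ltn_exp2l.
have char2 : 2%N \in [pchar F].
  by apply: (@card_finPcharP _ 2 (k * 2)); rewrite // cardF /s expnM.
have add_self (u : F) : u + u = 0 by apply: addrr_pchar2.
have frobD (u v : F) : (u + v) ^+ s = u ^+ s + v ^+ s.
  by apply: exprDn_pchar; rewrite /s pnatX pnatE // char2.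
have frobK (u : F) : (u ^+ s) ^+ s = u by rewrite -exprM mulnn -cardF expf_card.
have [-> | nz_t] := eqVneq t 0.
  have le_s : (#|slope_image (fun z : F => z ^+ s.+1) 0%R| <= s)%N.
    apply: leq_trans (card_binomial_fiber_leq F 1 1 0 s s_gt1 (oner_neq0 F)).
    apply: subset_leq_card; apply/subsetP => _ /imsetP[z _ ->].
    rewrite inE mul0r addr0 !mul1r.
    by rewrite exprS exprMn frobK mulrC add_self.
  rewrite mul2n -addnn leq_add // (leq_trans le_s) //.
  by rewrite cardF leq_pmulr // ltnW.
(* [A] is the set of fixed points of the involution [z |-> z + e / t], with
   [e] as below. *)
pose A := [set z : F | t ^+ s * z ^+ s + t * z == t ^+ s.+1].
apply: leq_trans (leq_double_card_imset _ _ _ A _) _; last first.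
  by rewrite leq_add2l card_binomial_fiber_leq // expf_neq0.
move=> z; rewrite inE => Az.
pose e := t ^+ s * z ^+ s + t * z + t ^+ s.+1.
have nz_e : e != 0.
  apply: contraNneq Az => e0; apply/eqP; rewrite -[RHS]add0r -e0.
  by rewrite /e -addrA add_self addr0.
have e_s : e ^+ s = e.
  by rewrite /e !frobD !exprMn exprS exprMn !frobK; ring.
exists (z + e / t); first by rewrite -subr_eq0 addrC addKr mulf_neq0 ?invr_neq0.
(* In characteristic 2 the last summand vanishes, being e (e + e) / t ^ (s + 1). *)
have -> : (z + e / t) ^+ s.+1 + t * (z + e / t)
   = z ^+ s.+1 + t * z
     + e * (t ^+ s * z ^+ s + t * z + t ^+ s.+1 + e) / t ^+ s.+1.
  rewrite exprS frobD exprMn exprVn e_s !exprS; field.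
  by rewrite expf_neq0 // nz_t.
by rewrite -/e add_self mulr0 mul0r addr0.
Qed.

Theorem theorem4 (R : rcfType) (F : finFieldType) (q m n : nat)
  (m_gt0 : (0 < m)%N) (m_even : ~~ odd m) (q_def : q = (2 ^ m)%N)
  (cardF : #|F| = q) (n_gt0 : (0 < n)%N) :
  exists K : {set 'rV[F]_n},
    kakeya K /\
    (#|K|%:R : R) <
      2 * q%:R / (q%:R + Num.sqrt q%:R - 2) * ((q%:R + Num.sqrt q%:R) / 2) ^+ n.
Proof.
have [k k_gt0 m_eq] : exists2 k, (0 < k)%N & m = (k + k)%N.
  exists m./2; last by rewrite addnn even_halfK.
  by case: m m_gt0 m_even {q_def} => [|[]].
pose s := (2 ^ k)%N; have s_gt1 : (1 < s)%N by rewrite -{1}(expn0 2) ltn_exp2l.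
have q_s : q = (s ^ 2)%N by rewrite q_def m_eq /s -mulnn expnD.
have sqrt_q : Num.sqrt (q%:R : R) = s%:R.
  by rewrite q_s natrX sqrtr_sqr ger0_norm // ler0n.
pose M := ((q + s) %/ 2)%N.
have even_qs : (M * 2 = q + s)%N.
  apply: divnK; rewrite q_s -mulnn dvdn_add ?dvdn_mull //;
  by rewrite /s -{1}(expn1 2) dvdn_exp2l.
have leM t : (#|slope_image (fun z : F => z ^+ s.+1) t| <= M)%N.
  rewrite /M leq_divRL // mulnC -{1}cardF.
  by apply: card_slope_image_norm; rewrite // cardF q_s.
have [K kakK leK] := exists_kakeya_slope_image _ _ _ _ n_gt0 leM.
exists K; split=> //; rewrite sqrt_q -natrD -even_qs natrM.
have q_gt0 : (0 : R) < q%:R by rewrite ltr0n q_s expn_gt0 ltnW.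
have M_gt1 : (1 : R) < M%:R.
  rewrite ltr1n /M leq_divRL // q_s -mulnn.
  by rewrite (leq_trans _ (leq_addr _ _)) // (leq_mul s_gt1 s_gt1).
apply: (@le_lt_trans _ _ (q%:R * \sum_(j < n) (M%:R : R) ^+ j)).
  rewrite -(ler_nat R) cardF natrM natr_sum in leK.
  by under [in X in _ <= X]eq_bigr do rewrite -natrX.
clearbody M.
have M1_gt0 : (0 : R) < M%:R - 1 by rewrite subr_gt0.
rewrite mulfK ?pnatr_eq0 //.
have -> : 2 * q%:R / (M%:R * 2 - 2) * M%:R ^+ n
    = q%:R * (M%:R ^+ n / (M%:R - 1)) :> R.
  by field; rewrite !lt0r_neq0 //; lra.
by rewrite ltr_pM2l // ltr_pdivlMr // mulrC -subrX1 ltrBlDr ltrDl ltr01.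
Qed.
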